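(* Let $p$ be a prime. For every integer $k\ge 1$, let $f_p(k)$ denote the smallest positive integer such that every abelian group of order $p^k$ has an integral of order $p^{f_p(k)}$. If $p$ is odd, then $f_p(k)=2k+1$ for every $k\ge 1$.
   Context: For a group $H$, $H'$ denotes the derived group (commutator subgroup) of $H$. An integral of a group $G$ is a group $H$ such that $H' \cong G$. *)

(* Defs.v *)
From mathcomp Require Import all_boot all_fingroup all_solvable.

Set Implicit Arguments.
Unset Strict Implicit.
Unset Printing Implicit Defensive.

Local Open Scope group_scope.

(* [H] is an integral of [G]; the two groups may live in different ambient
   types, since [G] is only required to be isomorphic to the derived group. *)
Definition integral (hT gT : finGroupType) (H : {group hT}) (G : {group gT}) :
  bool := H^`(1) \isog G.

Definition all_abelian_have_integral (p k m : nat) : Prop :=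
  forall (gT : finGroupType) (G : {group gT}),
    abelian G -> #|G| = (p ^ k)%N ->
    exists (hT : finGroupType) (H : {group hT}),
      integral H G /\ #|H| = (p ^ m)%N.

Definition least_positive (P : nat -> Prop) (m : nat) : Prop :=
  [/\ 0 < m, P m & forall n : nat, 0 < n -> P n -> m <= n].

(* The graph of f_p: a minimum exists only if some order works, so the number
   f_p(k) is described by a relation; [f_eq p k m] reads "f_p(k) exists and
   equals m" (the value is unique by antisymmetry of <=). *)
Definition f_eq (p k m : nat) : Prop :=
  least_positive (all_abelian_have_integral p k) m.

(* Main.v *)
Require Import Defs.
From mathcomp Require Import all_boot all_fingroup all_solvable.
From mathcomp Require Import zmodp zify.

(** The value 2k+1 is forced from below by the cyclic group of order p^k, and it
    is reached for every abelian group of order p^k by one construction.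

    Lower bound.  Let H be a finite p-group whose derived group H' is cyclic of
    order p^k, with k >= 1.  Commutators generate H', so one of them, [y, x],
    already has order p^k.  As p is odd, Aut H' is cyclic, so the
    automorphisms that x and y induce on H' are comparable: one is a power of
    the other, and y can be corrected by a power of x (or conversely) so that
    it centralises H' ([der1_cyclic_commutator]).  Put c = [y, x] and
    c ^ x = c ^+ r; then r = 1 mod p because H is nilpotent, and
      y ^ (x ^+ n) = y * c ^+ (1 + r + ... + r^(n-1)).
    For n = p^j and p odd the exponent has p-adic valuation exactly j
    ([logn_geometric_sum]).  If x^(p^(k-1)) were in H' it would commute with y,
    and p^k would divide an integer of valuation k-1.  Hence x has order at
    least p^k modulo H'; since H / H' is not cyclic (otherwise H would be, and
    H' = 1), |H / H'| >= p^(k+1), that is, |H| >= p^(2k+1).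

    Upper bound.  Split an abelian group G of order p^k as <x> \x D, where the
    order p^a of x is the exponent of G.  On B = C * D * D with C = <y> cyclic
    of order p^(a+1), consider the automorphism
      f (z, d, e) = (z^(p+1), d, d e).
    Its order is p^a: on C this is the same valuation computation, and on D * D
    the order divides the exponent of D, hence p^a.  In the semidirect product
    of B by <f> the derived group is the set of all b^-1 * f b = (z^p, 1, d),
    that is <y^p> * 1 * D, which is isomorphic to G, and the order is
    p^(a+1) * p^(2(k-a)) * p^a = p^(2k+1). *)

Set Implicit Arguments.
Unset Strict Implicit.
Unset Printing Implicit Defensive.

(** * Valuations of geometric sums *)

Lemma geometric_sum_gt0 r n : 0 < n -> 0 < \sum_(i < n) r ^ i.
Proof. by case: n => // n _; rewrite big_ord_recl expn0. Qed.

(** Modulo p^2 the i-th power of 1 + p w is 1 + i p w, so the sum is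
    p + p w 'C(p, 2), and an odd prime p divides 'C(p, 2). *)
Lemma geometric_sum_mod p w :
  prime p -> odd p ->
  \sum_(i < p) (p * w).+1 ^ i = p %[mod p ^ 2].
Proof.
move=> pr_p odd_p.
have expw i : (p * w).+1 ^ i = (i * (p * w)).+1 %[mod p ^ 2].
  elim: i => [|i IHi]; first by rewrite expn0 mul0n.
  rewrite expnS -modnMmr IHi modnMmr.
  have ->: ((p * w).+1 * (i * (p * w)).+1
            = (i * w * w) * p ^ 2 + (i.+1 * (p * w)).+1)%N.
    by rewrite -mulnn; lia.
  by rewrite modnMDl.
rewrite -modn_summ (eq_bigr _ (fun (i : 'I_p) _ => expw i)) modn_summ.
under eq_bigr do rewrite -addn1.
rewrite big_split -big_distrl sum1_card card_ord /=.
rewrite -(big_mkord xpredT (fun i => i)) bin2_sum.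
have p_gt2 : 2 < p by case: p pr_p odd_p {expw} => [|[|[]]].
have /dvdnP[q ->] : p %| 'C(p, 2) by rewrite prime_dvd_bin.
have ->: (q * p * (p * w) = q * w * p ^ 2)%N by rewrite -mulnn; lia.
by rewrite modnMDl.
Qed.

Lemma logn_geometric_sum_p p w :
  prime p -> odd p -> logn p (\sum_(i < p) (p * w).+1 ^ i) = 1.
Proof.
move=> pr_p odd_p; have p_gt1 := prime_gt1 pr_p.
have := geometric_sum_mod w pr_p odd_p.
set S := \sum_(i < p) _; rewrite (@modn_small p); last first.
  by rewrite -mulnn ltn_Pmull ?prime_gt0.
move=> Smod.
have S_gt0 : 0 < S.
  by case: posnP Smod => // ->; rewrite mod0n => p0; rewrite -p0 in p_gt1.
apply/eqP; rewrite eqn_leq -pfactor_dvdn // expn1 andbC.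
rewrite /dvdn -(modn_dvdm S (dvdn_mulr p (dvdnn p))) Smod modnn eqxx /=.
by rewrite leqNgt -pfactor_dvdn // /dvdn -mulnn Smod -lt0n ltnW.
Qed.

(** The sum of length p^(j+1) is the sum of length p^j with ratio r times the
    sum of length p with ratio r^(p^j), so each step adds exactly 1 to the
    valuation. *)
Lemma logn_geometric_sum p w j :
  prime p -> odd p -> logn p (\sum_(i < p ^ j) (p * w).+1 ^ i) = j.
Proof.
move=> pr_p odd_p; set r := (p * w).+1.
elim: j => [|j IHj]; first by rewrite expn0 big_ord1 expn0 logn1.
have pj_gt0 : 0 < p ^ j by rewrite expn_gt0 prime_gt0.
(* For r = 1 the factorisation r^n - 1 = (r - 1) * sum says nothing. *)
have [w0 | w_gt0] := posnP w.
  rewrite /r w0 muln0; under eq_bigr do rewrite exp1n.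
  by rewrite sum1_card card_ord pfactorK.
have r1_gt0 : 0 < r.-1 by rewrite /= muln_gt0 prime_gt0.
have /dvdnP[v def_v] : p %| (r ^ (p ^ j)).-1.
  by rewrite predn_exp /= -mulnA dvdn_mulr.
have def_rpj : r ^ (p ^ j) = (p * v).+1.
  by rewrite mulnC -def_v prednK // expn_gt0.
have splitS : \sum_(i < p ^ j.+1) r ^ i
   = ((\sum_(i < p ^ j) r ^ i) * \sum_(i < p) (r ^ (p ^ j)) ^ i)%N.
  apply/eqP; rewrite -(eqn_pmul2l r1_gt0) mulnA -!predn_exp.
  by rewrite expnSr expnM.
rewrite splitS lognM ?geometric_sum_gt0 // ?(prime_gt0 pr_p) // IHj.
by rewrite def_rpj logn_geometric_sum_p // addn1.
Qed.

Local Open Scope group_scope.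

(** * Groups with a cyclic derived group of odd prime power order *)

Lemma conj_expg_geometric (gT : finGroupType) (x y c : gT) r n :
  y ^ x = y * c -> c ^ x = c ^+ r ->
  y ^ (x ^+ n) = y * c ^+ (\sum_(i < n) r ^ i).
Proof.
move=> yx cx; elim: n => [|n IHn]; first by rewrite big_ord0 conjg1 mulg1.
rewrite expgSr conjgM IHn conjMg conjXg yx cx -mulgA -expgM -expgS.
rewrite big_ord_recl expn0 add1n big_distrr; congr (_ * _ ^+ _.+1).
by apply: eq_bigr => i _; rewrite /= -expnS.
Qed.

(** In an abelian group the solutions of a^(p^k) = 1 form a subgroup; if it
    contained A it would contain <<A>>, against the exponent. *)
Lemma abelian_gen_exponent_order (gT : finGroupType) (A : {set gT}) p k :
    prime p -> abelian <<A>> -> exponent <<A>> = (p ^ k.+1)%N ->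
  exists2 a, a \in A & #[a] = (p ^ k.+1)%N.
Proof.
move=> pr_p abA expA.
have [a Aa apk_neq1] : exists2 a, a \in A & a ^+ (p ^ k) != 1.
  apply/exists_inP; apply: contraTT isT.
  rewrite negb_exists_in => /forall_inP pkA.
  have: <<A>> \subset group (group_Ldiv (p ^ k) abA).
    rewrite gen_subG; apply/subsetP=> a Aa.
    by rewrite !inE mem_gen //= -[_ == _]negbK pkA.
  move/subsetP=> sLdiv; have: exponent <<A>> %| p ^ k.
    apply/exponentP=> x /sLdiv.
    by rewrite !inE => /andP[_ /eqP].
  by rewrite expA dvdn_Pexp2l ?prime_gt1 // ltnn.
exists a => //; have /(dvdn_pfactor _ _ pr_p)[i le_ik oa] : #[a] %| p ^ k.+1.
  by rewrite -expA dvdn_exponent ?mem_gen.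
rewrite oa; congr (_ ^ _)%N; apply/eqP; rewrite eqn_leq le_ik ltnNge.
by apply: contra apk_neq1 => le_ik'; rewrite -order_dvdn oa dvdn_exp2l.
Qed.

Lemma cyclic_pgroup_cycle_total
    (gT : finGroupType) (p : nat) (Q : {group gT}) a b :
  cyclic Q -> p.-group Q -> a \in Q -> b \in Q -> a \in <[b]> \/ b \in <[a]>.
Proof.
move=> cycQ pQ Qa Qb; rewrite -!cycle_subG.
have [sa sb] : <[a]> \subset Q /\ <[b]> \subset Q by rewrite !cycle_subG.
rewrite -(cardSg_cyclic cycQ sa sb) -(cardSg_cyclic cycQ sb sa).
rewrite (card_pgroup (pgroupS sa pQ)) (card_pgroup (pgroupS sb pQ)).
by case/orP: (leq_total (logn p #|<[a]>|) (logn p #|<[b]>|)) => le;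
  [left | right]; apply: dvdn_exp2l.
Qed.

Lemma cyclic_Aut_cyclic_pgroup (gT : finGroupType) (p : nat) (G : {group gT}) :
  odd p -> p.-group G -> cyclic G -> cyclic (Aut G).
Proof.
move=> odd_p pG cycG; have [-> | ntG] := eqVneq (G : {set gT}) 1.
  by rewrite Aut1 cyclic1.
have /= [m [_ [_ cycF _ _]]] := cyclic_pgroup_Aut_structure pG cycG ntG.
case: eqP => [_ -> // | _ [t [_ _ _]]].
by rewrite odd_p => -[[]].
Qed.

(** Aut H' is cyclic, so of the two automorphisms of H' induced by the entries
    of a generating commutator one is a power of the other; multiplying the
    corresponding entry by a power of the other one makes its action trivial
    and only conjugates the commutator. *)
Lemma der1_cyclic_commutator (hT : finGroupType) p k (H : {group hT}) :
    prime p -> odd p -> p.-group H ->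
    cyclic H^`(1) -> #|H^`(1)| = (p ^ k.+1)%N ->
  exists x y, [/\ x \in H, y \in 'C_H(H^`(1)) & #[[~ y, x]] = (p ^ k.+1)%N].
Proof.
move=> pr_p odd_p pH cycH' oH'.
have [_ /imset2P[x y Hx Hy ->] oxy] : exists2 a, a \in commg_set H H
    & #[a] = (p ^ k.+1)%N.
  apply: abelian_gen_exponent_order => //; first exact: cyclic_abelian.
  by rewrite -oH' -[<<_>>]/(H^`(1)) exponent_cyclic.
have pH' : p.-group H^`(1) := pgroupS (der_sub 1 H) pH.
have nH'H : H \subset 'N(H^`(1)) := der_norm 1 H.
set f := conj_aut (H^`(1))%G.
have cycQ : cyclic (f @* H).
  exact: cyclicS (Aut_conj_aut _ _) (cyclic_Aut_cyclic_pgroup odd_p pH' cycH').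
have fix_second u v : u \in H -> v \in H -> f v \in <[f u]> ->
    #[[~ v, u]] = (p ^ k.+1)%N ->
  exists x y, [/\ x \in H, y \in 'C_H(H^`(1)) & #[[~ y, x]] = (p ^ k.+1)%N].
  move=> Hu Hv /cycleP[j fv] ovu.
  have [Nu Nv] := (subsetP nH'H u Hu, subsetP nH'H v Hv).
  exists u, (v * u ^- j); split=> //.
    rewrite inE groupM ?groupV ?groupX //= -ker_conj_aut.
    apply/kerP; first by rewrite groupM ?groupV ?groupX.
    rewrite morphM ?groupV ?groupX // morphV ?groupX // morphX //.
    by rewrite (fv : conj_aut_morphism _ v = _) mulgV.
  have /commgP/eqP cuj : commute (u ^- j) u.
    by apply/commute_sym/commuteV/commuteX.
  by rewrite commMgJ cuj mulg1 orderJ.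
have Qf u : u \in H -> f u \in f @* H.
  by move=> Hu; rewrite mem_morphim // (subsetP nH'H).
have pQ : p.-group (f @* H) by rewrite morphim_pgroup.
have [fxy | fyx] := cyclic_pgroup_cycle_total cycQ pQ (Qf x Hx) (Qf y Hy).
  exact: fix_second fxy oxy.
by apply: fix_second fyx _; rewrite // -invg_comm orderV.
Qed.

(** Were x^(p^k) in H', it would commute with y, so that c = [y, x] would be
    killed by a geometric sum of valuation k, although its order is p^(k+1). *)
Lemma expg_notin_der1 (hT : finGroupType) p k (H : {group hT}) x y :
    prime p -> odd p -> p.-group H ->
    cyclic H^`(1) -> #|H^`(1)| = (p ^ k.+1)%N ->
    x \in H -> y \in 'C_H(H^`(1)) -> #[[~ y, x]] = (p ^ k.+1)%N ->
  x ^+ (p ^ k) \notin H^`(1).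
Proof.
move=> pr_p odd_p pH cycH' oH' Hx /setIP[Hy cH'y] oc.
set c := [~ y, x] in oc.
have H'c : c \in H^`(1) by rewrite mem_commg.
have defH' : <[c]> = H^`(1).
  by apply/eqP; rewrite eqEcard cycle_subG H'c oH' -orderE oc leqnn.
have [r cx] : exists r, c ^ x = c ^+ r.
  by apply/cycleP; rewrite defH' memJ_norm // (subsetP (der_norm 1 H)).
have c_neq1 : c != 1.
  by rewrite -order_eq1 oc -(exp1n k.+1) eqn_exp2r // neq_ltn prime_gt1 ?orbT.
have properD : [~: H^`(1), H] \proper H^`(1).
  apply: nil_comm_properl (pgroup_nil pH) (der_sub 1 H) _ _.
    by rewrite -cycle_eq1 defH' in c_neq1.
  by rewrite subsetI subxx der_norm.
have [r' def_r] : exists r', r = r'.+1.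
  case: r cx => [cx|r' _]; last by exists r'.
  by move: c_neq1; rewrite -(conjg_eq1 c x) cx expg0 eqxx.
(* Otherwise [c, x] = c^(r-1) would generate H', but [H', H] is proper in H'. *)
have p_r' : p %| r'.
  apply: contraT; rewrite -prime_coprime // => co_pr'.
  have gen_c : generator <[c]> (c ^+ r').
    by rewrite generator_coprime oc coprimeXl.
  case/negP: (proper_subn properD); rewrite -{1}defH' (eqP gen_c) cycle_subG.
  have ->: c ^+ r' = [~ c, x] by rewrite commgEl cx def_r expgS mulKg.
  exact: mem_commg.
have {p_r' def_r} [w def_r] : exists w, r = (p * w).+1.
  by case/dvdnP: p_r' => w def_r'; exists w; rewrite def_r def_r' mulnC.
apply/negP => H'xpk.
have yx : y ^ x = y * c by rewrite conjg_mulR.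
have: y ^ (x ^+ (p ^ k)) = y.
  by rewrite /conjg (centP cH'y _ H'xpk) mulKg.
rewrite (conj_expg_geometric _ yx cx) -[RHS]mulg1 => /mulgI/eqP.
rewrite -order_dvdn oc pfactor_dvdn //; last first.
  by rewrite geometric_sum_gt0 // expn_gt0 prime_gt0.
by rewrite def_r logn_geometric_sum // ltnn.
Qed.

(** H / H' contains an element of order at least p^(k+1) and is not cyclic, so
    its order is at least p^(k+2). *)
Lemma integral_of_cyclic_card (hT : finGroupType) p k n (H : {group hT}) :
    prime p -> odd p -> cyclic H^`(1) -> #|H^`(1)| = (p ^ k.+1)%N ->
    #|H| = (p ^ n)%N ->
  2 * k.+1 + 1 <= n.
Proof.
move=> pr_p odd_p cycH' oH' oH; have p_gt1 := prime_gt1 pr_p.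
have pH : p.-group H by rewrite /pgroup oH pnatX pnat_id.
have [x [y [Hx CHy oyx]]] := der1_cyclic_commutator pr_p odd_p pH cycH' oH'.
have not_H'x := expg_notin_der1 pr_p odd_p pH cycH' oH' Hx CHy oyx.
have le_kn : k < n.
  by rewrite -(leq_exp2l _ _ p_gt1) -oH -oH' subset_leq_card ?der_sub.
have oQ : #|H / H^`(1)| = (p ^ (n - k.+1))%N.
  by rewrite card_quotient ?der_norm // -divgS ?der_sub // oH oH' expnB // ltnW.
set X := coset H^`(1) x.
have QX : X \in H / H^`(1) by rewrite mem_quotient.
have Nx : x \in 'N(H^`(1)) by rewrite (subsetP (der_norm 1 H)).
have notX : X ^+ (p ^ k) != 1.
  apply: contra not_H'x => /eqP; rewrite -morphX //.
  by move/coset_idr; apply; rewrite groupX.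
have [t le_t oX] : exists2 t, t <= n - k.+1 & #[X] = (p ^ t)%N.
  by apply/(dvdn_pfactor _ _ pr_p); rewrite -oQ order_dvdG.
have lt_kt : k < t.
  rewrite ltnNge; apply: contra notX => le_tk.
  by rewrite -order_dvdn oX dvdn_exp2l.
rewrite leqNgt; apply/negP => lt_n.
have cycQ : cyclic (H / H^`(1)).
  apply/cyclicP; exists X; apply/eqP; rewrite eq_sym eqEcard cycle_subG QX.
  by rewrite oQ -orderE oX leq_exp2l //; lia.
have /cyclic_abelian/derG1P H'1 :=
  cyclic_nilpotent_quo_der1_cyclic (pgroup_nil pH) cycQ.
by move/eqP: oH'; rewrite H'1 cards1 eq_sym -(expn0 p) eqn_exp2l.
Qed.

(** * Integrals from automorphisms of abelian groups *)

(** H is the semidirect product of B by the cyclic group generated by f.  The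
    commutators of b with f are the values g b; as B is abelian they form a
    subgroup, normal in H because g commutes with f, and the quotient is
    generated by two commuting abelian groups. *)
Lemma integral_of_automorphism (gT : finGroupType) (B : {group gT})
    (f g : {morphism B >-> gT}) (injf : 'injm f) (imf : f @* B = B) :
    abelian B -> {in B, forall b, g b = b^-1 * f b} ->
  exists (hT : finGroupType) (H : {group hT}),
    H^`(1) \isog g @* B /\ #|H| = (#|B| * #[aut injf imf])%N.
Proof.
move=> abB gE; set a := aut injf imf.
have aE : {in B, a =1 f} := autE injf imf.
have Bf b : b \in B -> f b \in B by move=> Bb; rewrite -{2}imf mem_morphim.
have sgB : g @* B \subset B.
  by apply/subsetP=> _ /morphimP[b _ Bb ->]; rewrite gE // groupM ?groupV ?Bf.
have sAa : <[a]> \subset Aut B by rewrite cycle_subG Aut_aut.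
pose to := ([Aut B] \ sAa)%gact.
pose i1 := sdpair1 to; pose i2 := sdpair2 to.
have toE b : b \in B -> to b a = f b by move=> Bb; rewrite -aE.
pose K := i1 @* B; pose T := i1 @* (g @* B).
have conj_i1 b : b \in B -> i1 b ^ i2 a = i1 (f b).
  by move=> Bb; rewrite -toE // -sdpair_act // cycle_id.
have defL : i2 @* <[a]> = <[i2 a]> by rewrite morphim_cycle ?cycle_id.
have comm_i1 b : b \in B -> [~ i1 b, i2 a] = i1 (g b).
  move=> Bb; rewrite commgEl conj_i1 // gE //.
  by rewrite /i1 morphM ?groupV ?Bf // morphV.
have abK : abelian K by rewrite morphim_abelian.
have nTK : K \subset 'N(T) by rewrite sub_abelian_norm ?morphimS.
have nTa : i2 a \in 'N(T).
  rewrite inE; apply/subsetP=> _ /imsetP[z Tz ->].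
  case/morphimP: Tz => t _ gBt ->; case/morphimP: gBt => b _ Bb -> {z t}.
  have Bgb : g b \in B by rewrite (subsetP sgB) ?mem_morphim.
  rewrite conj_i1 // [g b]gE // morphM ?groupV ?Bf // morphV // -gE ?Bf //.
  by rewrite !mem_morphim ?Bf // (subsetP sgB) ?mem_morphim ?Bf.
have nTL : <[i2 a]> \subset 'N(T) by rewrite cycle_subG.
have defH : K * <[i2 a]> = setT by rewrite -defL im_sdpair.
exists (sdprod_by to), [set: sdprod_by to]%G; split; last first.
  rewrite -(sdprod_card (sdprod_sdpair to)).
  by rewrite !card_injm ?injm_sdpair1 ?injm_sdpair2.
have ->: [set: sdprod_by to]^`(1) = T.
  apply/eqP; rewrite eqEsubset; apply/andP; split.
    apply: der1_min; first by rewrite /= -defH mul_subG.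
    rewrite /= -defH quotientMl // abelianM.
    rewrite !quotient_abelian ?cycle_abelian //=.
    rewrite quotient_cycle // cycle_subG.
    apply/centP=> _ /morphimP[z Nz Kz ->].
    case/morphimP: Kz Nz => b _ Bb -> Nb.
    apply/esym/commgP; rewrite -morphR //= -/i1 comm_i1 //.
    by apply/eqP/coset_id; rewrite !mem_morphim // (subsetP sgB) ?mem_morphim.
  apply/subsetP=> _ /morphimP[_ _ /morphimP[b _ Bb ->] ->].
  suff: i1 (g b) \in [set: sdprod_by to]^`(1) by [].
  by rewrite -comm_i1 // mem_commg ?inE.
by rewrite isog_sym sub_isog ?injm_sdpair1.
Qed.

(** * The automorphism (z, d, e) |-> (z^(p+1), d, d e) *)

Section Shear.

Variables cT dT : finGroupType.
Variable p : nat.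
Hypotheses (abC : abelian [set: cT]) (abD : abelian [set: dT]).

Definition power_shear (u : cT * (dT * dT)) : cT * (dT * dT) :=
  (u.1 ^+ p.+1, (u.2.1, u.2.1 * u.2.2)).

(** The map b |-> b^-1 * power_shear b, see [power_shear_commutatorE]. *)
Definition power_shear_commutator (u : cT * (dT * dT)) : cT * (dT * dT) :=
  (u.1 ^+ p, (1, u.2.1)).

Let comC (x y : cT) : commute x y.
Proof. by apply: (centsP abC); rewrite inE. Qed.

Let comD (x y : dT) : commute x y.
Proof. by apply: (centsP abD); rewrite inE. Qed.

Lemma power_shear_morphM : {in setT &, {morph power_shear : u v / u * v}}.
Proof.
move=> [y [d e]] [y' [d' e']] _ _; congr (_, (_, _)) => /=.
  exact/expgMn/comC.
by rewrite -!mulgA; congr (_ * _); rewrite !mulgA (comD d').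
Qed.
Canonical power_shear_morphism := Morphism power_shear_morphM.

Lemma power_shear_commutator_morphM :
  {in setT &, {morph power_shear_commutator : u v / u * v}}.
Proof.
move=> [y [d e]] [y' [d' e']] _ _.
congr (_, (_, _)) => /=; last by rewrite mulg1.
exact/expgMn/comC.
Qed.
Canonical power_shear_commutator_morphism :=
  Morphism power_shear_commutator_morphM.

Lemma power_shear_commutatorE u :
  power_shear_commutator u = u^-1 * power_shear u.
Proof.
case: u => y [d e]; congr (_, (_, _)) => /=; first by rewrite expgS mulKg.
  by rewrite mulVg.
by rewrite (comD d) mulKg.
Qed.

Lemma injm_power_shear : coprime #|cT| p.+1 -> 'injm power_shear.
Proof.
move=> co_p; apply/subsetP=> -[y [d e]] /morphpreP[_ /set1P[yp -> /= e1]].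
rewrite !inE; rewrite mul1g in e1; rewrite e1.
have: y = 1.
  apply/eqP; rewrite -order_eq1 -dvdn1 -(eqnP co_p) dvdn_gcd -cardsT.
  by rewrite order_dvdG ?inE // order_dvdn yp eqxx.
by move->.
Qed.

Lemma im_power_shear : coprime #|cT| p.+1 -> power_shear @* setT = setT.
Proof.
move=> co_p; apply/eqP.
by rewrite eqEcard subsetT card_injm ?injm_power_shear // leqnn.
Qed.

Lemma im_power_shear_commutator y : [set: cT] = <[y]> ->
  power_shear_commutator @* setT = setX <[y ^+ p]> (setX 1 setT).
Proof.
move=> genC; apply/setP=> -[z [d e]]; rewrite !inE /= andbT; apply/morphimP/idP.
  case=> -[z' [d' e']] _ _.
  rewrite /= /power_shear_commutator /= => -[-> -> _].
  rewrite eqxx andbT; have /cycleP[i ->]: z' \in <[y]> by rewrite -genC inE.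
  by rewrite expgAC mem_cycle.
case/andP=> /cycleP[i ->] /eqP->.
by exists (y ^+ i, (e, 1)); rewrite ?inE //= /power_shear_commutator /= expgAC.
Qed.

Lemma iter_power_shear n u :
  iter n power_shear u = (u.1 ^+ (p.+1 ^ n), (u.2.1, u.2.1 ^+ n * u.2.2)).
Proof.
case: u => y [d e]; elim: n => [|n IHn] /=; first by rewrite expg1 mul1g.
by rewrite IHn /power_shear /= -expgM -expnSr expgS mulgA.
Qed.

End Shear.

(** The p^j-th power of the shear acts on C as the power map of exponent
    (p+1)^(p^j), and (p+1)^(p^j) - 1 = p * (geometric sum) has valuation j + 1;
    hence it fixes C, of order p^(a+1), exactly when a <= j.  The factor D * D adds
    nothing, since the exponent of D divides p^a. *)
Lemma order_power_shear (cT dT : finGroupType) p a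
    (abC : abelian [set: cT]) (abD : abelian [set: dT])
    (injf : 'injm (power_shear_morphism p abC abD))
    (imf : power_shear_morphism p abC abD @* setT = setT) y :
    prime p -> odd p -> #[y : cT] = (p ^ a.+1)%N -> [set: cT] = <[y]> ->
    exponent [set: dT] %| p ^ a ->
  #[aut injf imf] = (p ^ a)%N.
Proof.
move=> pr_p odd_p oy genC expD; set f := aut injf imf.
have fX n u : (f ^+ n) u = iter n (power_shear p) u.
  by rewrite permX; apply: eq_iter => v; rewrite autE ?inE.
have p_gt0 := prime_gt0 pr_p.
have sum_gt0 j : 0 < \sum_(i < p ^ j) p.+1 ^ i.
  by rewrite geometric_sum_gt0 // expn_gt0 p_gt0.
have logp j : logn p (p.+1 ^ (p ^ j)).-1 = j.+1.
  rewrite predn_exp lognM ?sum_gt0 //= (logn_prime _ pr_p) eqxx.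
  by have := logn_geometric_sum 1 j pr_p odd_p; rewrite muln1 => ->.
have fixC j : (y ^+ (p.+1 ^ (p ^ j)) == y) = (a <= j).
  rewrite -(prednK (n := (p.+1 ^ _)%N)) ?expn_gt0 // expgS.
  rewrite -[X in _ == X]mulg1 (inj_eq (mulgI y)) -order_dvdn oy.
  by rewrite pfactor_dvdn ?logp // predn_exp muln_gt0 p_gt0 sum_gt0.
have f_dvd : #[f] %| p ^ a.
  rewrite order_dvdn; apply/eqP/permP=> -[z [d e]].
  rewrite fX iter_power_shear perm1 /=; congr (_, (_, _)).
    have /cycleP[i ->]: z \in <[y]> by rewrite -genC inE.
    have /eqP fix_y : y ^+ (p.+1 ^ (p ^ a)) == y by rewrite fixC.
    by rewrite expgAC fix_y.
  by rewrite (exponentP expD) ?mul1g ?inE.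
have /(dvdn_pfactor _ _ pr_p)[j le_ja of_] := f_dvd.
rewrite of_; congr (_ ^ _)%N; apply/eqP; rewrite eqn_leq le_ja -fixC.
have /permP/(_ (y, (1, 1))) : f ^+ (p ^ j) = 1 by rewrite -of_ expg_order.
by rewrite fX iter_power_shear perm1 /= => -[->].
Qed.

(** * Optimal integrals of abelian groups of order p^k *)

Lemma Zp1_generates n :
  1 < n -> [set: 'Z_n] = <[Zp1 : 'Z_n]> /\ #[Zp1 : 'Z_n] = n.
Proof.
move=> n_gt1; have genZ : [set: 'Z_n] = <[Zp1 : 'Z_n]>.
  by apply/setP=> z; rewrite inE -Zp_cycle inE.
by split=> //; rewrite orderE -genZ cardsT card_ord Zp_cast.
Qed.

Lemma integral_of_shear (cT dT : finGroupType) p a (y : cT) :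
    prime p -> odd p -> #[y] = (p ^ a.+1)%N -> [set: cT] = <[y]> ->
    abelian [set: dT] -> exponent [set: dT] %| p ^ a ->
  exists (hT : finGroupType) (H : {group hT}),
    H^`(1) \isog setX <[y ^+ p]> (setX [1 dT] [set: dT])
    /\ #|H| = (p ^ (2 * a + 1) * #|dT| ^ 2)%N.
Proof.
move=> pr_p odd_p oy genC abD expD.
have abC : abelian [set: cT] by rewrite genC cycle_abelian.
have oC : #|cT| = (p ^ a.+1)%N by rewrite -cardsT genC.
have co_p : coprime #|cT| p.+1 by rewrite oC coprimeXl ?coprimenS.
have comD (d e : dT) : d * e = e * d by apply: (centsP abD); rewrite inE.
have comC (z t : cT) : z * t = t * z by apply: (centsP abC); rewrite inE.
have abB : abelian [set: cT * (dT * dT)].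
  by apply/centsP=> -[z [d e]] _ [z' [d' e']] _; congr (_, (_, _)) => /=.
have injf := injm_power_shear abC abD co_p.
have imf := im_power_shear abC abD co_p.
have [hT [H [isoH oH]]] := integral_of_automorphism injf imf abB
  (g := power_shear_commutator_morphism dT p abC)
  (fun b _ => power_shear_commutatorE p abD b).
exists hT, H; split.
  by rewrite -(im_power_shear_commutator dT p abC genC).
rewrite oH (order_power_shear injf imf pr_p odd_p oy genC expD).
rewrite cardsT !card_prod oC mulnAC -expnD mulnn; congr (_ ^ _ * _)%N; lia.
Qed.

(** A cyclic factor <x> of order exponent G is a direct factor.  The shear turns
    it into the p-th powers of a cyclic group p times as large, and turns the
    complement D into the second copy of D. *)
Lemma abelian_pgroup_integral (gT : finGroupType) p k (G : {group gT}) :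
    prime p -> odd p -> abelian G -> #|G| = (p ^ k)%N ->
  exists (hT : finGroupType) (H : {group hT}),
    integral H G /\ #|H| = (p ^ (2 * k + 1))%N.
Proof.
move=> pr_p odd_p abG oG; have p_gt0 := prime_gt0 pr_p.
have [x Gx ox] := exponent_witness (abelian_nil abG).
have /splitsP[D /complP[tiXD defG]] := abelian_splits Gx (esym ox) abG.
have sDG : D \subset G by rewrite -defG mulG_subr.
have {tiXD}defG : <[x]> \x D = G.
  by rewrite dprodE // (sub_abelian_cent2 abG) ?cycle_subG.
have [a le_ak oxa] : exists2 a, a <= k & #[x] = (p ^ a)%N.
  by apply/(dvdn_pfactor _ _ pr_p); rewrite -oG order_dvdG.
have q_gt1 : (1 < p ^ a.+1)%N by rewrite -{1}(expn0 p) ltn_exp2l ?prime_gt1.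
pose cT := 'Z_(p ^ a.+1).
have [genC oy] : [set: cT] = <[Zp1]> /\ #[Zp1 : cT] = _ := Zp1_generates q_gt1.
have abD : abelian [set: subg_of D].
  by rewrite -[[set: _]]im_subg morphim_abelian // (abelianS sDG).
have expD : exponent [set: subg_of D] %| p ^ a.
  apply/exponentP=> d _; apply: subg_inj; rewrite morphX ?inE // morph1.
  apply/eqP; rewrite -order_dvdn -oxa -ox.
  by rewrite dvdn_exponent // (subsetP sDG) ?subgP.
have oD : #|subg_of D| = (p ^ (k - a))%N.
  rewrite -cardsT -[[set: _]]im_subg card_injm ?injm_subg //.
  rewrite expnB // -oG -(dprod_card defG) -orderE oxa mulKn //.
  by rewrite expn_gt0 p_gt0.
have [hT [H [isoH oH]]] := integral_of_shear pr_p odd_p oy genC abD expD.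
exists hT, H; split; last first.
  rewrite oH oD -expnM -expnD; congr (_ ^ _)%N; lia.
rewrite /integral (isog_trans isoH) // isog_sym.
apply: isog_dprod defG (setX_dprod _ _) _ _; last first.
  apply: isog_trans (isog_subg D) _.
  exact: isog_trans (isog_set1X _ _) (isog_set1X _ _).
apply: isog_trans (isog_setX1 _ _).
rewrite isog_cyclic_card ?cycle_cyclic //= -!orderE oxa orderXdiv oy.
  by rewrite expnS mulKn.
by rewrite expnS dvdn_mulr.
Qed.

Close Scope group_scope.

Theorem theorem5p3 (p : nat) (p_prime : prime p) (p_odd : odd p)
    (k : nat) (k_ge1 : 1 <= k) :
  f_eq p k (2 * k + 1).
Proof.
case: k k_ge1 => // k _; split=> [|gT G|n _ int_n]; first by rewrite addn1.
  exact: abelian_pgroup_integral.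
have q_gt1 : 1 < p ^ k.+1 by rewrite -{1}(expn0 p) ltn_exp2l ?prime_gt1.
have [genZ oZ] := Zp1_generates q_gt1.
have cycZ : cyclic [set: 'Z_(p ^ k.+1)] by rewrite genZ cycle_cyclic.
have oZT : #|[set: 'Z_(p ^ k.+1)]| = p ^ k.+1 by rewrite genZ -orderE oZ.
have [hT [H [isoH oH]]] :=
  int_n _ [set: 'Z_(p ^ k.+1)]%G (cyclic_abelian cycZ) oZT.
apply: (integral_of_cyclic_card p_prime p_odd _ _ oH).
  by rewrite (isog_cyclic isoH).
by rewrite (card_isog isoH).
Qed.
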